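(* Let $f:\mathbb{T}^2\to\mathbb{T}^2$ be a non-resonant torus homeomorphism, and let $\Omega(f)$ be its non-wandering set. Then $f|_{\Omega(f)}$ is weakly transitive; that is, for any two open sets $U,V\subset\mathbb{T}^2$ with $U\cap\Omega(f)\neq\emptyset$ and $V\cap\Omega(f)\neq\emptyset$, there exists $n>0$ such that $f^n(U)\cap V\neq\emptyset$.
   Context: $\mathbb{T}^2=\mathbb{R}^2/\mathbb{Z}^2$. $\mathrm{Homeo}_0(\mathbb{T}^2)$ is the set of homeomorphisms of $\mathbb{T}^2$ homotopic to the identity. The rotation set of a lift $F:\mathbb{R}^2\to\mathbb{R}^2$ of $f\in\mathrm{Homeo}_0(\mathbb{T}^2)$ is the set of all limits of sequences $\frac{F^{n_i}(z_i)-z_i}{n_i}$ with $z_i\in\mathbb{R}^2$, $n_i\to+\infty$; changing the lift translates it by an integer vector. $f\in\mathrm{Homeo}_0(\mathbb{T}^2)$ is called non-resonant if its rotation set is a single vector $(\alpha,\beta)$ (defined modulo $\mathbb{Z}^2$) such that $1,\alpha,\beta$ are rationally independent (linearly independent over $\mathbb{Q}$). Equivalently, for every lift $F$ and every $z\in\mathbb{R}^2$, $\lim_{n\to\infty}\frac{F^n(z)-z}{n}=(\alpha,\beta)\ (\mathrm{mod}\ \mathbb{Z}^2)$ with $1,\alpha,\beta$ rationally independent. The non-wandering set $\Omega(f)$ is the set of points $x$ such that for every neighborhood $U$ of $x$ there exists $n>0$ with $f^n(U)\cap U\neq\emptyset$. For a homeomorphism $h:M\to M$ and an $h$-invariant compact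 set $K$, $h|_K$ is weakly transitive if for any two open sets $U,V$ of $M$ intersecting $K$ there exists $n>0$ with $h^n(U)\cap V\neq\emptyset$ (the open sets are open in $M$, not relatively open in $K$). *)

(* Defs.v *)
From HB Require Import structures.
From mathcomp Require Import all_boot all_order all_algebra.
From mathcomp Require Import all_classical all_reals all_analysis.

Set Implicit Arguments.
Unset Strict Implicit.
Unset Printing Implicit Defensive.

Import Order.TTheory GRing.Theory Num.Theory.
Import numFieldNormedType.Exports.

Local Open Scope classical_set_scope.
Local Open Scope ring_scope.
Local Open Scope quotient_scope.

Section torus.
Variable R : realType.

Definition torus_rel (x y : R * R) : bool :=
  (x.1 - y.1 \is a Num.int) && (x.2 - y.2 \is a Num.int).

Lemma torus_rel_refl : reflexive torus_rel.
Proof. by move=> x; rewrite /torus_rel !subrr rpred0. Qed.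

Lemma torus_rel_sym : symmetric torus_rel.
Proof.
by move=> x y; rewrite /torus_rel -(opprB x.1) -(opprB x.2) !rpredN.
Qed.

Lemma torus_rel_trans : transitive torus_rel.
Proof.
move=> y x z /andP[xy1 xy2] /andP[yz1 yz2]; apply/andP; split.
- by rewrite -(subrKA y.1) rpredD.
- by rewrite -(subrKA y.2) rpredD.
Qed.

Canonical torus_equiv :=
  EquivRel torus_rel torus_rel_refl torus_rel_sym torus_rel_trans.

Definition torus := {eq_quot torus_equiv}.

HB.instance Definition _ := Topological.copy torus (quotient_topology torus).
HB.instance Definition _ := Quotient.on torus.

Definition torus_proj : R * R -> torus := \pi_torus.

End torus.

Definition homeomorphism (X Y : topologicalType) (f : X -> Y) : Prop :=
  continuous f /\
  exists g : Y -> X, [/\ continuous g, cancel f g & cancel g f].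

Definition homotopic (R : realType) (X Y : topologicalType) (f g : X -> Y) :
    Prop :=
  exists H : R * X -> Y,
    [/\ {within `[0, 1] `*` [set: X], continuous H},
        forall x, H (0, x) = f x & forall x, H (1, x) = g x].

Definition homeo0 (R : realType) (f : torus R -> torus R) : Prop :=
  homeomorphism f /\ homotopic R f idfun.

Definition is_lift (R : realType) (f : torus R -> torus R)
    (F : R * R -> R * R) : Prop :=
  continuous F /\ forall z, torus_proj (F z) = f (torus_proj z).

Definition rotation_set (R : realType) (F : R * R -> R * R) : set (R * R) :=
  [set v : R * R | exists (z : nat -> R * R) (n : nat -> nat),
    n i @[i --> \oo] --> \oo /\
    (n i)%:R^-1 *: (iter (n i) F (z i) - z i) @[i --> \oo] --> v].

Definition rationally_independent (R : realType) (a b : R) : Prop :=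
  forall p q r : rat, ratr p + ratr q * a + ratr r * b = 0 ->
    [/\ p = 0, q = 0 & r = 0].

(* Two lifts differ by an integer translation, which translates the rotation
   set by the same vector; so it does not matter which lift is used. *)
Definition non_resonant (R : realType) (f : torus R -> torus R) : Prop :=
  homeo0 f /\
  exists (F : R * R -> R * R) (v : R * R),
    [/\ is_lift f F, rotation_set F = [set v] &
        rationally_independent v.1 v.2].

Definition non_wandering_set (X : topologicalType) (f : X -> X) : set X :=
  [set x | forall U, nbhs x U ->
    exists n, (0 < n)%N /\ (iter n f @` U) `&` U !=set0].

(* U and V are open in the ambient space, not just relatively open in K. *)
Definition weakly_transitive_on (X : topologicalType) (h : X -> X) (K : set X) :
    Prop :=
  forall U V : set X, open U -> open V ->
    U `&` K !=set0 -> V `&` K !=set0 ->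
    exists n, (0 < n)%N /\ (iter n h @` U) `&` V !=set0.

(* Main.v *)
Require Import Defs.
From mathcomp Require Import all_boot all_order all_algebra.
From mathcomp Require Import all_classical all_reals all_analysis.
From mathcomp Require Import ring lra.
Set Implicit Arguments.
Unset Strict Implicit.
Unset Printing Implicit Defensive.
Import Order.TTheory GRing.Theory Num.Theory.
Import numFieldNormedType.Exports.
Local Open Scope classical_set_scope.
Local Open Scope ring_scope.

(** Let [F] be a lift of [f] and [v] its rotation vector. Being homotopic to the
    identity, [f] has lifts that commute with the lattice translations
    ([lift_equivariant]), and compactness then turns the hypothesis on the
    rotation set into a uniform estimate: [iter n F z - z] differs from
    [n *: v] by [o(n)], uniformly in [z] ([singleton_rotation_set_drift]).

    Let [U] and [V] meet the non-wandering set. A disk over [V] returns to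
    itself up to a lattice vector: for some [k > 0], the map
    [H = iter k F - q] sends a point of it into the same disk. Likewise some
    [G = iter n F - p] does so for a disk over [U]. The segment joining a point
    to its image stays in the disk, and its images under the powers of [G]
    form a curve which goes to infinity in the direction [n *: v - p] with a
    sublinear deviation; its points are future iterates of the first disk. In
    the same way the inverse of [H] gives a curve of past iterates of the
    second disk, going in the direction [- (k *: v - q)]
    ([return_drifting_curves]).

    If these two directions are not parallel, suitable lattice translates of
    the two curves cross, by the Poincare-Miranda theorem
    ([drifting_curves_cross]); a crossing point is, on the torus, the image of
    a point of [U] which later enters [V]. By rational independence the
    directions are parallel only if [p / n = q / k], and the disk over [U] can
    be chosen so small that it has no such return: since orbits drift, these
    could only occur for finitely many [n], and each of the finitely many maps
    [iter n F - p] is without fixed points ([nonparallel_return]).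

    The Poincare-Miranda theorem itself is obtained from a parity count on a
    grid ([mixed_cell]). *)

(** * A parity argument on a grid *)

(** A square form of Sperner's lemma in dimension two. Label a vertex A when
    [a] holds, B when only [b] holds, C otherwise, and call an edge odd when
    its ends carry B and C. A cell on which [a] or [b] is constant has an even
    number of odd sides: either B and C do not both occur, or A does not occur
    and the label changes an even number of times around the cell. If every cell
    were of this kind, summing over the cells of a column of cells would show
    that consecutive vertical lines of the grid have the same parity of odd
    edges: the bottom line carries no C and the top line no B, so they
    contribute nothing. But the leftmost line is all A, hence even, whereas the
    rightmost line goes from B to C without meeting A, hence is odd. *)
Lemma mixed_cell (N : nat) (a b : nat -> nat -> bool) :
  (forall j, (j <= N)%N -> a 0 j) ->
  (forall j, (j <= N)%N -> ~~ a N j) ->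
  (forall i, (i <= N)%N -> b i 0) ->
  (forall i, (i <= N)%N -> ~~ b i N) ->
  exists i j, [/\ (i < N)%N, (j < N)%N,
    ~~ ((a i j == a i.+1 j) && (a i j == a i j.+1) && (a i j == a i.+1 j.+1)) &
    ~~ ((b i j == b i.+1 j) && (b i j == b i j.+1) && (b i j == b i.+1 j.+1))].
Proof.
move=> aL aR bB bT; apply: contrapT => none.
pose e (i j i' j' : nat) := [&& ~~ a i j, ~~ a i' j' & b i j (+) b i' j'].
(* [V i] is the parity of the number of odd edges on the vertical line [i]. *)
pose V i := \big[addb/false]_(j < N) e i j i j.+1.
have VS i : (i < N)%N -> V i.+1 = V i.
  move=> iN; suff H M : (M <= N)%N ->
      (\big[addb/false]_(j < M) e i j i j.+1) (+)
      (\big[addb/false]_(j < M) e i.+1 j i.+1 j.+1) = e i 0 i.+1 0 (+) e i M i.+1 M.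
    have := H N (leqnn N); rewrite -/(V i) -/(V i.+1) /e !bB ?(ltnW iN) //.
    rewrite !(negbTE (bT _ _)) ?(ltnW iN) // !andbF.
    by rewrite addbF => /eqP; rewrite addbC; case: (V i) => [];  case: (V i.+1).
  elim: M => [_|M IH MN]; first by rewrite !big_ord0 !addbb.
  rewrite !big_ord_recr /=.
  move: (IH (ltnW MN)); set x := bigop _ _ _; set y := bigop _ _ _ => xy.
  rewrite addbACA xy -addbA; congr addb.
  have : ~ (~~ ((a i M == a i.+1 M) && (a i M == a i M.+1) && (a i M == a i.+1 M.+1)) /\
    ~~ ((b i M == b i.+1 M) && (b i M == b i M.+1) && (b i M == b i.+1 M.+1))).
    by move=> [h1 h2]; apply: none; exists i, M.
  rewrite /e; move: (a i M) (a i.+1 M) (a i M.+1) (a i.+1 M.+1) (b i M) (b i.+1 M) (b i M.+1) (b i.+1 M.+1).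
  by do 8!case=> //; case.
have V0 : V 0 = false.
  rewrite /V big1 // => j _; rewrite /e aL //; exact: ltnW.
have VN i : (i <= N)%N -> V i = false.
  by elim: i => // i IH iN; rewrite VS // IH // ltnW.
have VNE M : (M <= N)%N ->
    \big[addb/false]_(j < M) e N j N j.+1 = b N 0 (+) b N M.
  elim: M => [|M IH] MN; first by rewrite big_ord0 addbb.
  rewrite big_ord_recr /= IH ?(ltnW MN) // /e !(negbTE (aR _ _)) ?(ltnW MN) //=.
  by rewrite addbA -(addbA (b N 0)) addbb addbF.
have := VNE N (leqnn N).
by rewrite -/(V N) (VN N (leqnn N)) bB // (negbTE (bT _ _)).
Qed.

(** * The Poincare-Miranda theorem in the plane *)

Section Plane.
Variable R : realType.
Implicit Types (p q z : R * R).

Lemma plane_eq p q : p.1 = q.1 -> p.2 = q.2 -> p = q.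
Proof. by case: p q => [? ?] [? ?] /= -> ->. Qed.

Lemma plane_norm_lt p (e : R) : (`|p| < e) = (`|p.1| < e) && (`|p.2| < e).
Proof. by rewrite prod_normE gt_max. Qed.

Lemma plane_norm_le p (e : R) : (`|p| <= e) = (`|p.1| <= e) && (`|p.2| <= e).
Proof. by rewrite prod_normE ge_max. Qed.

Lemma plane_ballE p q (e : R) : ball p e q = (`|p - q| < e).
Proof. by rewrite ball_prod_normE. Qed.

Lemma square_compact (a b c d : R) : compact (`[a, b] `*` `[c, d] : set (R * R)).
Proof. by apply: compact_setX; exact: segment_compact. Qed.

Lemma sign_near (g : R * R -> R) p : continuous g -> g p != 0 ->
  \forall r \near 0^'+, forall q, `|p - q| < r -> (g q < 0) = (g p < 0).
Proof.
move=> gc gp0.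
have : \forall q \near p, (g q < 0) = (g p < 0).
  move: gp0; rewrite neq_lt => /orP[gp|gp].
  - have gq : \forall q \near p, g q < 0 := gc p _ (lt_nbhsl gp).
    by apply: filterS gq => q ->; rewrite gp.
  - have gq : \forall q \near p, 0 < g q := gc p _ (lt_nbhsr gp).
    apply: filterS gq => {}q gq.
    by rewrite !ltNge !ltW.
move=> /nbhs_ballP[r /= r0 rp]; near=> s => q pq; apply: rp.
by rewrite plane_ballE; apply: (lt_trans pq); near: s; exact: nbhs_right_lt.
Unshelve. all: by end_near. Qed.

(** A Lebesgue number: near a point where [h] does not vanish one of its two
    coordinates keeps its sign, and compactness of the square makes the radius
    uniform. *)
Lemma sign_lebesgue (h : R * R -> R * R) (L : R) : continuous h ->
  (forall p, (`[0, L] `*` `[0, L]) p -> h p != 0) ->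
  \forall d \near 0^'+, forall p, (`[0, L] `*` `[0, L]) p ->
    (forall q, `|p - q| < d -> ((h q).1 < 0) = ((h p).1 < 0)) \/
    (forall q, `|p - q| < d -> ((h q).2 < 0) = ((h p).2 < 0)).
Proof.
move=> hc h0; pose K : set (R * R) := `[0, L] `*` `[0, L].
have /compact_near_coveringP cK : compact K by exact: square_compact.
have half (g : R * R -> R) p : continuous g -> g p != 0 ->
    \forall p' \near p & d \near (0 : R)^'+,
       forall q, `|p' - q| < d -> (g q < 0) = (g p' < 0).
  move=> gc gp; have [r /= r0 rP] := sign_near gc gp.
  have {}rP q : `|p - q| < r / 2 -> (g q < 0) = (g p < 0).
    apply: rP => /=; last by rewrite divr_gt0.
    by rewrite sub0r normrN gtr0_norm ?divr_gt0 // gtr_pMr // invf_lt1 // ltr1n.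
  near=> p' d => q pq.
  have pp' : `|p - p'| < r / 2 / 2.
    near: p'; apply/nbhs_ballP; exists (r / 2 / 2) => /=; first by rewrite !divr_gt0.
    by move=> y; rewrite plane_ballE.
  have dr : d < r / 2 / 2 by near: d; apply: nbhs_right_lt; rewrite !divr_gt0.
  rewrite (rP p') ?rP //.
    rewrite -(subrKA p') (le_lt_trans (ler_normD _ _)) //.
    by rewrite [ltRHS]splitr ltrD // (lt_trans pq).
  by rewrite (lt_trans pp') // gtr_pMr ?divr_gt0 // invf_lt1 // ltr1n.
apply: cK => p Kp.
have : (h p).1 != 0 \/ (h p).2 != 0.
  apply/orP; rewrite -negb_and; apply: contra (h0 p Kp) => /andP[/eqP h1 /eqP h2].
  by apply/eqP; rewrite (surjective_pairing (h p)) h1 h2.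
have c1 : continuous (fst \o h) by move=> x; apply: continuous_comp; [exact: hc|exact: cvg_fst].
have c2 : continuous (snd \o h) by move=> x; apply: continuous_comp; [exact: hc|exact: cvg_snd].
by case=> [/(half _ _ c1)|/(half _ _ c2)]; apply: filterS => -[p' d] /= ?; [left|right].
Unshelve. all: by end_near. Qed.

(** If [h] had no zero, a grid finer than the Lebesgue number of
    [sign_lebesgue] would have no cell on which both coordinates change sign,
    against [mixed_cell]. *)
Lemma poincare_miranda (h : R * R -> R * R) (L : R) : 0 < L -> continuous h ->
  (forall t, 0 <= t <= L -> (h (0, t)).1 < 0 < (h (L, t)).1) ->
  (forall s, 0 <= s <= L -> (h (s, 0)).2 < 0 < (h (s, L)).2) ->
  exists p, [/\ 0 <= p.1 <= L, 0 <= p.2 <= L & h p = 0].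
Proof.
move=> L0 hc hx hy; apply: contrapT => none.
have h0 p : (`[0, L] `*` `[0, L]) p -> h p != 0.
  move=> [p1 p2]; apply/eqP => hp; apply: none; exists p.
  by move: p1 p2; rewrite /= !in_itv /=.
have [d /= d0 dP] := sign_lebesgue hc h0.
have {}dP p : (`[0, L] `*` `[0, L]) p ->
    (forall q, `|p - q| < d / 2 -> ((h q).1 < 0) = ((h p).1 < 0)) \/
    (forall q, `|p - q| < d / 2 -> ((h q).2 < 0) = ((h p).2 < 0)).
  apply: dP => /=; last by rewrite divr_gt0.
  by rewrite sub0r normrN gtr0_norm ?divr_gt0 // gtr_pMr // invf_lt1 // ltr1n.
pose N := (Num.truncn (L / (d / 2))).+1.
have NL : L / N%:R < d / 2.
  rewrite ltr_pdivrMr ?ltr0n // mulrC -ltr_pdivrMr ?divr_gt0 //.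
  exact: truncnS_gt.
pose g (i : nat) : R := i%:R * (L / N%:R).
have g0 : g 0 = 0 by rewrite /g mul0r.
have gN : g N = L by rewrite /g mulrC divfK // pnatr_eq0.
have gS i : g i.+1 - g i = L / N%:R by rewrite /g -mulrBl -natrB // subSnn mul1r.
have gb i : (i <= N)%N -> 0 <= g i <= L.
  move=> iN; have q0 : 0 <= L / N%:R by rewrite divr_ge0 ?ltW.
  by rewrite mulr_ge0 //= -[leRHS]gN ler_wpM2r // ler_nat.
have [|||| i [j [iN jN]]] := @mixed_cell N (fun i j => (h (g i, g j)).1 < 0)
   (fun i j => (h (g i, g j)).2 < 0).
- by move=> j jN; rewrite g0; case/andP: (hx _ (gb _ jN)).
- by move=> j jN; rewrite gN -leNgt; case/andP: (hx _ (gb _ jN)) => _ /ltW.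
- by move=> j jN; rewrite g0; case/andP: (hy _ (gb _ jN)).
- by move=> j jN; rewrite gN -leNgt; case/andP: (hy _ (gb _ jN)) => _ /ltW.
have LN0 : 0 <= L / N%:R by rewrite divr_ge0 ?ltW.
have near1 (i' j' : nat) : (i' == i) || (i' == i.+1) -> (j' == j) || (j' == j.+1) ->
    `|(g i, g j) - (g i', g j')| < d / 2.
  move=> ii jj; rewrite plane_norm_lt /=; apply/andP; split.
  - by case/orP: ii => /eqP ->; rewrite ?subrr ?normr0 ?divr_gt0 // distrC gS ger0_norm.
  - by case/orP: jj => /eqP ->; rewrite ?subrr ?normr0 ?divr_gt0 // distrC gS ger0_norm.
have [|dx|dy] := dP (g i, g j).
- by split; rewrite /= in_itv /= gb // ltnW.
- by rewrite !dx ?eqxx // near1 ?eqxx ?orbT.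
- by move=> _; rewrite !dy ?eqxx // near1 ?eqxx ?orbT.
Qed.

End Plane.

Ltac plane_ring := apply: plane_eq; rewrite /= /GRing.scale /=; ring.

(** * Curves drifting in transverse directions *)

Section Crossing.
Variable R : realType.
Implicit Types (p q z w : R * R) (S : set (R * R)).

Definition lattice (m : R * R) : bool := (m.1 \is a Num.int) && (m.2 \is a Num.int).

(** Finite pieces, of any length but with a common error bound, of a curve in
    [S] that stays sublinearly close to the ray directed by [w]. Asking for
    finite pieces only avoids gluing infinitely many arcs. *)
Definition drifting_curves S w : Prop := forall e : R, 0 < e ->
  exists C : R, forall K : nat, exists g : R -> R * R, continuous g /\
    forall t, 0 <= t <= K%:R -> S (g t) /\ `|g t - t *: w| <= e * t + C.

(** The determinant of the pair, which vanishes exactly when [w] and [w'] are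
    parallel. *)
Definition cross w w' : R := w.1 * w'.2 - w.2 * w'.1.

Lemma lattice_approx z : exists m, lattice m /\ `|z - m| <= 1.
Proof.
exists ((Num.floor z.1)%:~R, (Num.floor z.2)%:~R).
split; first by rewrite /lattice /= !intr_int.
have H (x : R) : `|x - (Num.floor x)%:~R| <= 1.
  have /andP[h1 h2] := floor_itv x.
  rewrite ger0_norm ?subr_ge0 // lerBlDl; move: h2; rewrite intrD => /ltW; lra.
by rewrite plane_norm_le /= !H.
Qed.

Lemma cross_bound w x : `|cross w x| <= 2 * `|w| * `|x|.
Proof.
have n1 z : `|z.1| <= `|z| by rewrite prod_normE le_max lexx.
have n2 z : `|z.2| <= `|z| by rewrite prod_normE le_max lexx orbT.
rewrite (le_trans (ler_normB _ _)) // -mulrA mulr2n mulrDl !mul1r !normrM.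
by rewrite lerD // ler_pM.
Qed.

(** Take pieces of length [L] of both curves, and translate the second by a
    lattice vector so that the two rays would cross near their midpoints. In
    the coordinates [phi], [psi] given by the basis [w], [- w'], the difference
    [g s - g' t - m] is [(s - L / 2, t - L / 2)] up to an error smaller than
    [L / 2] when [L] is large: it satisfies the sign conditions of
    [poincare_miranda] on the square of side [L], and a zero of it is a common
    point of the two curves modulo the lattice. *)
Lemma drifting_curves_cross S S' w w' : cross w w' != 0 ->
  drifting_curves S w -> drifting_curves S' w' ->
  exists a b, [/\ S a, S' b & lattice (a - b)].
Proof.
move=> D0 Sw Sw'; set D := cross w w' in D0.
pose phi x := - (cross w' x) / D; pose psi x := - (cross w x) / D.
(* [M] bounds the operator norms of [phi] and [psi]. *)
pose M := (2 * (`|w| + `|w'|) + 1) / `|D|.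
have M0 : 0 < M by rewrite divr_gt0 ?normr_gt0 // ltr_wpDl // mulr_ge0 // addr_ge0.
have phiM x : `|phi x| <= M * `|x|.
  rewrite /phi /M normrM normrN normfV mulrAC ler_wpM2r ?invr_ge0 //.
  rewrite (le_trans (cross_bound _ _)) // ler_wpM2r //.
  by have := normr_ge0 w; lra.
have psiM x : `|psi x| <= M * `|x|.
  rewrite /psi /M normrM normrN normfV mulrAC ler_wpM2r ?invr_ge0 //.
  rewrite (le_trans (cross_bound _ _)) // ler_wpM2r //.
  by have := normr_ge0 w'; lra.
pose e := (8 * M)^-1.
have e0 : 0 < e by rewrite invr_gt0 mulr_gt0.
have [C CP] := Sw _ e0; have [C' CP'] := Sw' _ e0.
(* The drift error of both pieces is at most [2 * e * L], which [M] turns into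
   [L / 4]; the length [L = K%:R] is such that the constants also cost less
   than [L / 4]. *)
pose K := (Num.truncn `|4 * M * (C + C' + 1)|).+1.
have KP : M * (C + C' + 1) < K%:R / 4.
  rewrite ltr_pdivlMr // mulrC mulrA (le_lt_trans (ler_norm _)) //.
  exact: truncnS_gt.
have {CP} [g [gc gP]] := CP K; have {CP'} [g' [gc' gP']] := CP' K.
set L : R := K%:R in KP gP gP'.
have L0 : 0 < L by rewrite ltr0n.
have [m [ml mP]] := lattice_approx ((L / 2) *: (w - w')).
pose h p := g p.1 - g' p.2 - m.
pose err p := (g p.1 - p.1 *: w) - (g' p.2 - p.2 *: w') + ((L / 2) *: (w - w') - m).
have phiE p : phi (h p) = p.1 - L / 2 + phi (err p).
  rewrite /phi /h /err /D /cross /= /GRing.scale /=; field; exact: D0.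
have psiE p : psi (h p) = p.2 - L / 2 + psi (err p).
  rewrite /psi /h /err /D /cross /= /GRing.scale /=; field; exact: D0.
have errP p : 0 <= p.1 <= L -> 0 <= p.2 <= L -> M * `|err p| < L / 2.
  move=> /[dup] /andP[p10 p1L] /gP[_ h1] /[dup] /andP[p20 p2L] /gP'[_ h2].
  have eM : M * e = 8^-1 by rewrite /e; field; rewrite gt_eqF.
  have : `|err p| <= e * p.1 + C + (e * p.2 + C') + 1.
    rewrite (le_trans (ler_normD _ _)) // lerD //.
    by rewrite (le_trans (ler_normB _ _)) // lerD.
  rewrite -(ler_pM2l M0) => /le_lt_trans; apply.
  have : M * e * (p.1 + p.2) <= M * e * (L + L) by rewrite ler_wpM2l ?lerD // eM.
  rewrite eM; nra.
have hc : continuous h.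
  move=> p; rewrite /h; apply: cvgB; last exact: cvg_cst.
  apply: cvgB; apply: continuous_comp.
  - exact: cvg_fst.
  - exact: gc.
  - exact: cvg_snd.
  - exact: gc'.
have cont1 (u : R * R) : continuous (fun p : R * R => - (cross u (h p)) / D).
  move=> p; rewrite /cross; apply: cvgM; last exact: cvg_cst.
  apply: cvgN; apply: cvgB; apply: cvgM; try exact: cvg_cst;
    apply: (@continuous_comp _ _ _ h); by [exact: hc|exact: cvg_fst|exact: cvg_snd].
have [|||p [p1 p2 /pair_equal_spec[phi0 psi0]]] :=
    @poincare_miranda _ (fun p => (phi (h p), psi (h p))) L L0.
- by move=> p; apply: (@cvg_pair _ _ _ _ (nbhs (phi (h p))) (nbhs (psi (h p)))); [exact: (cont1 w')|exact: (cont1 w)].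
- move=> t tL; rewrite /= !phiE /=.
  have L1 : 0 <= (0 : R) <= L by rewrite lexx ltW.
  have L2 : 0 <= L <= L by rewrite lexx ltW.
  have := le_lt_trans (phiM _) (errP (0, t) L1 tL).
  have := le_lt_trans (phiM _) (errP (L, t) L2 tL).
  by rewrite !ltr_norml; lra.
- move=> t tL; rewrite /= !psiE /=.
  have L1 : 0 <= (0 : R) <= L by rewrite lexx ltW.
  have L2 : 0 <= L <= L by rewrite lexx ltW.
  have := le_lt_trans (psiM _) (errP (t, 0) tL L1).
  have := le_lt_trans (psiM _) (errP (t, L) tL L2).
  by rewrite !ltr_norml; lra.
have hp0 : h p = 0.
  have -> : h p = phi (h p) *: w - psi (h p) *: w'.
    apply: plane_eq; rewrite /phi /psi /D /cross /= /GRing.scale /=; field; exact: D0.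
  by rewrite phi0 psi0 !scale0r subrr.
exists (g p.1), (g' p.2); split; [by have [] := gP _ p1|by have [] := gP' _ p2|].
by move/eqP: hp0; rewrite subr_eq0 => /eqP ->.
Qed.

End Crossing.

(** * Curves made of the iterates of a segment *)

Section Chains.
Variable R : realType.
Implicit Types (p q z w : R * R) (G : R * R -> R * R).

(** Uniform convergence of the mean displacement to [w]; the constant takes
    care of the small times, so that the estimate holds at all of them. *)
Definition uniform_drift G w : Prop := forall e : R, 0 < e ->
  exists C : R, forall (n : nat) z, `|iter n G z - z - n%:R *: w| <= e * n%:R + C.

Definition clamp (u : R) : R := Num.max 0 (Num.min u 1).

Lemma clamp_le0 u : u <= 0 -> clamp u = 0.
Proof. by move=> u0; rewrite /clamp; apply/max_idPl; rewrite ge_min u0. Qed.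

Lemma clamp_ge1 u : 1 <= u -> clamp u = 1.
Proof. by move=> u1; rewrite /clamp (min_idPr u1); apply/max_idPr. Qed.

Lemma clamp_itv u : 0 <= clamp u <= 1.
Proof. by rewrite /clamp le_max lexx ge_max ler01 ge_min lexx orbT. Qed.

Lemma clamp_continuous : continuous clamp.
Proof.
move=> u; rewrite /clamp; apply: (@continuous_max R R (cst 0) (fun u => Num.min u 1)).
  exact: cvg_cst.
by apply: (@continuous_min R R idfun (cst 1)); [exact: cvg_id|exact: cvg_cst].
Qed.

Lemma ball_segment x r p q (u : R) : 0 <= u <= 1 ->
  ball x r p -> ball x r q -> ball x r (p + u *: (q - p)).
Proof.
rewrite !plane_ballE => /andP[u0 u1] xp xq.
have -> : x - (p + u *: (q - p)) = (1 - u) *: (x - p) + u *: (x - q).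
  by plane_ring.
rewrite (le_lt_trans (ler_normD _ _)) // !normrZ !ger0_norm ?subr_ge0 //.
have [u2|u2] := leP u (1 / 2).
  have : 0 < (1 - u) * (r - `|x - p|) by rewrite mulr_gt0 ?subr_gt0 //; lra.
  have : 0 <= u * (r - `|x - q|) by rewrite mulr_ge0 ?subr_ge0 // ltW.
  lra.
have : 0 <= (1 - u) * (r - `|x - p|) by rewrite mulr_ge0 ?subr_ge0 // ltW.
have : 0 < u * (r - `|x - q|) by rewrite mulr_gt0 ?subr_gt0 //; lra.
lra.
Qed.

Lemma iter_continuous (T : topologicalType) (g : T -> T) n :
  continuous g -> continuous (iter n g).
Proof.
move=> gc; elim: n => [|n IH] x; first exact: cvg_id.
by apply: (@continuous_comp _ _ _ (iter n g) g); [exact: IH|exact: gc].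
Qed.

(** The concatenation of the arcs [iter k.+1 G s], for [s] the segment from [z]
    to [G z] and [k < K], the arc of index [k] being parametrized by [k, k + 1].
    Each term of the sum is constant outside that interval and the sum
    telescopes there, so that continuity needs no gluing. *)
Definition chain G z (K : nat) (t : R) : R * R :=
  G z + \sum_(k < K)
    (iter k.+1 G (z + clamp (t - k%:R) *: (G z - z)) - iter k.+1 G z).

Lemma chain_continuous G z K : continuous G -> continuous (chain G z K).
Proof.
move=> Gc.
have segc k : continuous (fun t : R => z + clamp (t - k%:R) *: (G z - z)).
  move=> t; apply: cvgD; first exact: cvg_cst.
  apply: cvgZr_tmp.
  apply: (@continuous_comp _ _ _ (fun t : R => t - k%:R) clamp).
    by apply: (@cvgB _ R); [exact: cvg_id|exact: cvg_cst].
  exact: clamp_continuous.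
have termc k : continuous
    (fun t : R => iter k.+1 G (z + clamp (t - k%:R) *: (G z - z)) - iter k.+1 G z).
  move=> t; apply: cvgB; last exact: cvg_cst.
  apply: (@continuous_comp _ _ _ (fun t : R => z + clamp (t - k%:R) *: (G z - z)) (iter k.+1 G)).
    exact: segc.
  exact: iter_continuous.
move=> t; apply: cvgD; first exact: cvg_cst.
elim: K => [|K IH].
  by rewrite big_ord0; under eq_fun do rewrite big_ord0; exact: cvg_cst.
rewrite big_ord_recr; under eq_fun do rewrite big_ord_recr.
by apply: cvgD; [exact: IH|exact: termc].
Qed.

Lemma chainE G z (K : nat) t : 0 <= t <= K%:R ->
  exists j : nat, j%:R <= t <= j.+1%:R /\
    chain G z K t = iter j.+1 G (z + clamp (t - j%:R) *: (G z - z)).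
Proof.
have saturated k s : k%:R <= s -> chain G z k s = iter k.+1 G z.
  elim: k => [|k IH] ks; first by rewrite /chain big_ord0 addr0.
  have k1s : k%:R <= s by rewrite (le_trans _ ks) // ler_nat.
  rewrite /chain big_ord_recr /= addrA -/(chain G z k s) IH // clamp_ge1.
    by rewrite scale1r subrKC /= subrKC -iterSr.
  by move: ks; rewrite -natr1; lra.
elim: K => [|K IH] /andP[t0 tK].
  exists 0%N; rewrite t0 (le_trans tK) //; split=> //.
  by rewrite /chain big_ord0 addr0 clamp_le0 ?scale0r ?addr0 // subr0.
have [tK'|/ltW tK'] := leP t K%:R.
  have [|j [jt jE]] := IH; first by rewrite t0.
  exists j; split => //; rewrite -jE /chain big_ord_recr /=.
  by rewrite clamp_le0 ?subr_le0 // scale0r addr0 subrr addr0.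
exists K; rewrite tK' tK; split => //.
by rewrite /chain big_ord_recr /= addrA -/(chain G z K t) saturated // subrKC.
Qed.

(** A disk containing [z] and [G z] contains the segment between them; the
    successive images of this segment are joined end to end and drift in the
    direction [w]. The images start at the first one, so that every point of
    the curve comes from the disk after a positive time. *)
Lemma return_drifting_curves G w x r z : continuous G -> uniform_drift G w ->
  ball x r z -> ball x r (G z) ->
  drifting_curves [set p | exists k q, ball x r q /\ p = iter k.+1 G q] w.
Proof.
move=> Gc Gw xz xGz e e0; have [C CP] := Gw e e0.
exists (e + C + (`|x| + r) + `|w|) => K; exists (chain G z K).
split; first exact: chain_continuous.
move=> t tK; have [j [/andP[jt tj] ->]] := chainE G z tK.
set q := z + _; have xq : ball x r q by apply: ball_segment => //; exact: clamp_itv.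
split; first by exists j, q.
have -> : iter j.+1 G q - t *: w =
    (iter j.+1 G q - q - j.+1%:R *: w) + q + (j.+1%:R - t) *: w.
  by set a := iter _ _ _; plane_ring.
have qb : `|q| <= `|x| + r.
  rewrite -[q](subKr x) (le_trans (ler_normB _ _)) // lerD //.
  by move: xq; rewrite plane_ballE => /ltW.
have wb : `|(j.+1%:R - t) *: w| <= `|w|.
  rewrite normrZ ler_piMl // ger0_norm ?subr_ge0 //.
  by move: jt; rewrite -natr1; lra.
rewrite (le_trans (ler_normD _ _)) // [leRHS]addrA lerD //.
rewrite (le_trans (ler_normD _ _)) // [leRHS]addrA lerD //.
rewrite (le_trans (CP _ _)) // addrA lerD2r -natr1 mulrDr mulr1 lerD2r.
by rewrite ler_wpM2l // ltW.
Qed.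

End Chains.

(** * The torus and its universal cover *)

Section Torus.
Variable R : realType.
Implicit Types (p q z w m : R * R).

Lemma latticeN m : lattice (- m) = lattice m.
Proof. by rewrite /lattice /= !rpredN. Qed.

Lemma latticeD m m' : lattice m -> lattice m' -> lattice (m + m').
Proof. by move=> /andP[h1 h2] /andP[h3 h4]; rewrite /lattice /= !rpredD. Qed.

Lemma latticeB m m' : lattice m -> lattice m' -> lattice (m - m').
Proof. by move=> h h'; rewrite latticeD // latticeN. Qed.

Lemma latticeMn m n : lattice m -> lattice (n%:R *: m).
Proof.
by move=> /andP[h1 h2]; rewrite /lattice /= /GRing.scale /= !rpredM ?rpred_nat.
Qed.

Lemma small_lattice m : lattice m -> `|m| < 1 -> m = 0.
Proof.
move=> /andP[m1 m2]; rewrite plane_norm_lt => /andP[h1 h2].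
have H (x : R) : x \is a Num.int -> `|x| < 1 -> x = 0.
  move=> xi x1; apply/eqP; apply: contraTT x1 => x0.
  by rewrite -leNgt norm_intr_ge1.
by rewrite (surjective_pairing m) (H _ m1 h1) (H _ m2 h2).
Qed.

Lemma lattice_square z : exists w, (`[0, 1] `*` `[0, 1]) w /\ lattice (z - w).
Proof.
exists (z.1 - (Num.floor z.1)%:~R, z.2 - (Num.floor z.2)%:~R); split.
  have H (x : R) : 0 <= x - (Num.floor x)%:~R <= 1.
    have /andP[h1 h2] := floor_itv x.
    by rewrite subr_ge0 h1 lerBlDl ltW //; move: h2; rewrite intrD; lra.
  by split; rewrite /= in_itv /= H.
by rewrite /lattice /= !subKr !intr_int.
Qed.

Lemma torus_projP z w : torus_proj z = torus_proj w <-> lattice (z - w).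
Proof.
have -> : lattice (z - w) = torus_equiv R z w by [].
by split=> [/eqquotP|] // h; apply/eqquotP.
Qed.

Lemma torus_projD z m : lattice m -> torus_proj (z + m) = torus_proj z.
Proof. by move=> lm; apply/torus_projP; rewrite addrC addKr. Qed.

Lemma torus_proj_surj (x : torus R) : exists z, torus_proj z = x.
Proof. by exists (repr x); exact: reprK. Qed.

Lemma torus_proj_continuous : continuous (@torus_proj R).
Proof. exact: pi_continuous. Qed.

Lemma torus_proj_nbhs z (r : R) : 0 < r ->
  nbhs (torus_proj z) (@torus_proj R @` ball z r).
Proof.
move=> r0; apply: open_nbhs_nbhs; split; last by exists z => //; exact: ballxx.
change (open (@torus_proj R @^-1` (@torus_proj R @` ball z r))).
rewrite openE => w [c zc /torus_projP lcw].
have : \forall w' \near w, ball z r (w' + (c - w)).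
  have cc : continuous (fun w' => w' + (c - w)).
    by move=> x; apply: cvgD; [exact: cvg_id|exact: cvg_cst].
  apply: cc; rewrite /= addrC subrK.
  by apply: open_nbhs_nbhs; split => //; exact: ball_open.
apply: filterS => w' h; exists (w' + (c - w)) => //.
by rewrite torus_projD.
Qed.

(** A lift of a continuous map, continuous or not, varies little near each
    point up to a lattice vector; to prove it continuous one only has to
    exclude a nonzero vector. *)
Lemma lift_near (Z : topologicalType) (h : Z -> torus R) (phi : Z -> R * R) :
  continuous h -> (forall z : Z, torus_proj (phi z) = h z) ->
  forall (z : Z) (e : R), 0 < e ->
    \forall z' \near z, exists m, lattice m /\ `|phi z' - m - phi z| < e.
Proof.
move=> hc phih z e e0.
have : \forall z' \near z, (@torus_proj R @` ball (phi z) e) (h z').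
  by apply: hc; rewrite -phih; exact: torus_proj_nbhs.
apply: filterS => z' [c zc]; rewrite -phih => /esym/torus_projP l.
exists (phi z' - c); split => //.
by rewrite subKr distrC -plane_ballE.
Qed.

(** Connectedness of the line, in the form in which it serves as an induction
    principle on a real parameter. *)
Lemma locally_constant_prop (P : R -> Prop) (a b : R) :
  (forall s, \forall s' \near s, P s' <-> P s) -> P a -> P b.
Proof.
move=> Ploc Pa.
have oP (Q : R -> Prop) : (forall s, \forall s' \near s, Q s' <-> Q s) ->
    open [set s | Q s].
  by move=> Qloc; rewrite openE => s Qs; apply: filterS (Qloc s) => s' /= ->.
have cT : connected [set: R] by apply/connected_intervalP.
have PT : [set s | P s] = setT; last first.
  by have : [set: R] b by []; rewrite -PT.
apply: cT.
- by exists a.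
- by exists [set s | P s]; rewrite ?setTI //; exact: oP.
- exists [set s | P s]; rewrite ?setTI //; rewrite -openC; apply: oP => s.
  by apply: filterS (Ploc s) => s' Ps; split=> nP Q; apply: nP; exact/Ps.
Qed.

End Torus.

(** * Lifts of maps homotopic to the identity *)

Section Lifts.
Variable R : realType.
Implicit Types (p q z w m : R * R) (F phi : R * R -> R * R).

Definition equivariant F : Prop := forall z m, lattice m -> F (z + m) = F z + m.

Definition equivariant_lift (h : R * R -> torus R) phi : Prop :=
  [/\ continuous phi, forall z, torus_proj (phi z) = h z & equivariant phi].

Definition close (x y : torus R) : Prop :=
  exists a b, [/\ torus_proj a = x, torus_proj b = y & `|a - b| < 1 / 4].

Lemma close_sym x y : close x y -> close y x.
Proof. by move=> [a [b [ax bY ab]]]; exists b, a; rewrite distrC. Qed.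

(** Lifts are transported to a uniformly close map [h']: above each point take
    the unique value lying over [h'] at distance less than 1/4 from [phi].
    Uniqueness makes the choice equivariant, and lattice vectors being at
    distance at least 1 makes it continuous. *)
Lemma equivariant_lift_close (h h' : R * R -> torus R) :
  continuous h' -> (forall z m, lattice m -> h' (z + m) = h' z) ->
  (forall z, close (h z) (h' z)) ->
  (exists phi, equivariant_lift h phi) -> exists phi, equivariant_lift h' phi.
Proof.
move=> hc' hper hh' [phi [phic phih phiE]].
have /choice[psi psiP] z : exists b, torus_proj b = h' z /\ `|phi z - b| < 1 / 4.
  have [a [b [ah bh ab]]] := hh' z.
  exists (b + (phi z - a)); split; last by have -> : phi z - (b + (phi z - a)) = a - b by plane_ring.
  by rewrite torus_projD //; apply/torus_projP; rewrite phih ah.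
exists psi; split; last 1 first.
- move=> z m lm; apply/eqP; rewrite -subr_eq0; apply/eqP; apply: small_lattice.
    apply/torus_projP; rewrite torus_projD //.
    by rewrite !(proj1 (psiP _)) hper.
  have -> : psi (z + m) - (psi z + m) =
      (phi z - psi z) - (phi (z + m) - psi (z + m)).
    by rewrite phiE //; plane_ring.
  rewrite (le_lt_trans (ler_normB _ _)) //.
  have [_ h1] := psiP z; have [_ h2] := psiP (z + m); lra.
- move=> z; apply/cvgrPdist_lt => e e0.
  have d0 : 0 < Num.min e (1 / 4) by rewrite lt_min e0 /= divr_gt0.
  have lpsi z' : torus_proj (psi z') = h' z' by have [] := psiP z'.
  have phiz : \forall z' \near z, `|phi z - phi z'| < 1 / 4.
    by move/cvgrPdist_lt: (phic z); apply.
  apply: filterS2 phiz (lift_near hc' lpsi z d0) => z' phiz [m [lm]].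
  rewrite lt_min => /andP[me m4].
  suff m0 : m = 0 by rewrite distrC; move: me; rewrite m0 subr0.
  apply: small_lattice => //.
  have -> : m = (psi z' - phi z') + (phi z' - phi z) + (phi z - psi z) - (psi z' - m - psi z).
    by plane_ring.
  rewrite (le_lt_trans (ler_normB _ _)) //.
  have h1 := ler_normD (psi z' - phi z' + (phi z' - phi z)) (phi z - psi z).
  have h2 := ler_normD (psi z' - phi z') (phi z' - phi z).
  have [_ h3] := psiP z; have [_ h4] := psiP z'.
  by move: h1 h2 h3 h4 phiz; rewrite (distrC (phi z') (psi z')) (distrC (phi z) (phi z')); lra.
- by move=> z; have [] := psiP z.
Qed.

(** Tube lemma: by periodicity it is enough to treat the unit square, which is
    compact. *)
Lemma homotopy_close (K : R * (R * R) -> torus R) s : continuous K ->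
  (forall s z m, lattice m -> K (s, z + m) = K (s, z)) ->
  \forall s' \near s, forall z, close (K (s, z)) (K (s', z)).
Proof.
move=> Kc Kper.
have /compact_near_coveringP cK := @square_compact R 0 1 0 1.
have : \forall s' \near s, (`[0, 1] `*` `[0, 1]) `<=` (fun z => close (K (s, z)) (K (s', z))).
  apply: (cK R (nbhs s) (fun s' z => close (K (s, z)) (K (s', z)))) => z _; have [c cz] := torus_proj_surj (K (s, z)).
  have : nbhs (K (s, z)) (@torus_proj R @` ball c (1 / 8)).
    by rewrite -cz; apply: torus_proj_nbhs; rewrite divr_gt0.
  move=> /Kc [[A B] /= [As Bz] AB]; exists (B, A) => //= -[z' s'] /= [Bz' As'].
  have [a ca az] : (@torus_proj R @` ball c (1 / 8)) (K (s, z')).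
    by apply: (AB (s, z')); split => //=; exact: nbhs_singleton.
  have [b cb bz] : (@torus_proj R @` ball c (1 / 8)) (K (s', z')).
    exact: (AB (s', z')).
  exists a, b; split => //; move: ca cb; rewrite !plane_ballE => ca cb.
  rewrite -(subrKA c) (le_lt_trans (ler_normD _ _)) // distrC; lra.
apply: filterS => s' sP z; have [w [ws lw]] := lattice_square z.
by rewrite -(subrKC w z) !Kper //; exact: sP.
Qed.

(** Having an equivariant lift is a locally constant property of the time of
    the homotopy, by [homotopy_close] and [equivariant_lift_close], and it
    holds at time 1, where the identity is a lift. *)
Lemma homotopic_equivariant_lift (f : torus R -> torus R) :
  homotopic R f idfun -> exists phi, equivariant_lift (f \o @torus_proj R) phi.
Proof.
move=> [H [Hc H0 H1]].
(* Clamping the time extends the homotopy to all of [R]. *)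
pose K (p : R * (R * R)) := H (clamp p.1, torus_proj p.2).
have Kc : continuous K.
  move=> p U HU; pose x : R * torus R := (clamp p.1, torus_proj p.2).
  have xA : (`[0, 1] `*` [set: torus R]) x by split => //=; rewrite in_itv /= clamp_itv.
  pose A : set (R * torus R)%type := `[0, 1] `*` [set: torus R].
  have : @nbhs_subspace (R * torus R)%type A x (H @^-1` U) := Hc x U HU.
  rewrite -nbhs_subspace_in // => xU.
  have cx : (fun p : R * (R * R) => (clamp p.1, torus_proj p.2)) @ p --> x.
    apply: (@cvg_pair _ _ _ _ (nbhs x.1) (nbhs x.2)).
    - by apply: (@continuous_comp _ _ _ fst (@clamp R)); [exact: cvg_fst|exact: clamp_continuous].
    - by apply: (@continuous_comp _ _ _ snd (@torus_proj R)); [exact: cvg_snd|exact: torus_proj_continuous].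
  have pU : \forall q \near p, A (clamp q.1, torus_proj q.2) -> U (K q) := cx _ xU.
  apply: filterS pU => q; apply; split => //=.
  by rewrite in_itv /= clamp_itv.
have Ksc s : continuous (fun z => K (s, z)).
  move=> z; apply: (@continuous_comp _ _ _ (fun z => (s, z)) K); last exact: Kc.
  by apply: (@cvg_pair _ _ _ _ (nbhs s) (nbhs z)); [exact: cvg_cst|exact: cvg_id].
have Kper s z m : lattice m -> K (s, z + m) = K (s, z).
  by move=> lm; rewrite /K /= torus_projD.
pose P s := exists phi, equivariant_lift (fun z => K (s, z)) phi.
have : P 0.
  apply: (@locally_constant_prop _ P 1).
    move=> s; apply: filterS (homotopy_close s Kc Kper) => s' ss'; split.
    - apply: equivariant_lift_close => //; last by move=> z; exact/close_sym.
      by move=> z m; exact: Kper.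
    - apply: equivariant_lift_close => //.
      by move=> z m; exact: Kper.
  exists idfun; split => //; first by move=> z; exact: cvg_id.
  by move=> z; rewrite /K /= clamp_ge1 ?lexx // H1.
move=> [phi [phic phiK phiE]]; exists phi; split => // z.
by rewrite phiK /K /= clamp_le0 ?lexx // H0.
Qed.

(** Two lifts of the same map differ by a continuous map with values in the
    lattice, which is constant; so every lift inherits the equivariance of the
    one that comes from the homotopy. *)
Lemma lift_equivariant (f : torus R -> torus R) F :
  homotopic R f idfun -> is_lift f F -> equivariant F.
Proof.
move=> /homotopic_equivariant_lift[phi [phic phif phiE]] [Fc Ff] z m lm.
pose d z := F z - phi z.
have dl w : lattice (d w) by apply/torus_projP; rewrite Ff phif.
pose u (s : R) := d (z + s *: m).
have uc : continuous u.
  move=> s; apply: (@continuous_comp _ _ _ (fun s : R => z + s *: m) d).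
    by apply: cvgD; [exact: cvg_cst|apply: cvgZr_tmp; exact: cvg_id].
  by apply: cvgB; [exact: Fc|exact: phic].
have : u 1 = u 0.
  apply: (@locally_constant_prop _ (fun s => u s = u 0) 0) => // s.
  have : \forall s' \near s, `|u s - u s'| < 1 by move/cvgrPdist_lt: (uc s); apply.
  apply: filterS => s' ss'; suff -> : u s' = u s by [].
  apply/esym/eqP; rewrite -subr_eq0; apply/eqP; apply: small_lattice => //.
  by apply: latticeB; exact: dl.
rewrite /u /d scale1r scale0r addr0 phiE // => E.
by rewrite -[F (z + m)](subrK (phi z + m)) E addrA subrK.
Qed.

End Lifts.

(** * Uniform drift of non-resonant lifts *)

Section Rotation.
Variable R : realType.
Implicit Types (p q z w v m : R * R) (F G : R * R -> R * R).

Lemma equivariant_iter F n : equivariant F -> equivariant (iter n F).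
Proof. by move=> FE z m lm; elim: n => //= n ->; rewrite FE. Qed.

Lemma bounded_displacement F : continuous F -> equivariant F ->
  exists B : R, forall z, `|F z - z| <= B.
Proof.
move=> Fc FE; pose d z := F z - z.
have dc : continuous d by move=> z; apply: cvgB; [exact: Fc|exact: cvg_id].
have : compact (d @` (`[0, 1] `*` `[0, 1])).
  by apply: continuous_compact; [exact: continuous_subspaceT|exact: square_compact].
move=> /compact_bounded [M [_ MP]]; exists (M + 1) => z.
have [w [ws lw]] := lattice_square z.
have -> : F z - z = d w by rewrite -{1}(subrKC w z) FE // /d; plane_ring.
by apply: (MP (M + 1)); [rewrite ltrDl|exists w].
Qed.

Lemma iter_displacement F (B : R) n z : (forall z, `|F z - z| <= B) ->
  `|iter n F z - z| <= n%:R * B.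
Proof.
move=> FB; elim: n => [|n IH]; first by rewrite subrr normr0 mul0r.
rewrite /= -(subrKA (iter n F z)) (le_trans (ler_normD _ _)) //.
by rewrite -natr1 mulrDl mul1r addrC lerD.
Qed.

(** Equivariance makes the displacement of [F] bounded. If the drift towards
    [v] were not uniform, there would be times and points with mean
    displacement at distance more than [e] from [v]; the added constant [i]
    forces these times to infinity, and boundedness gives a limit point of the
    mean displacements, which is a second element of the rotation set. *)
Lemma singleton_rotation_set_drift F v : continuous F -> equivariant F ->
  rotation_set F = [set v] -> uniform_drift F v.
Proof.
move=> Fc FE Fv e e0; have [B FB] := bounded_displacement Fc FE.
have B0 : 0 <= B := le_trans (normr_ge0 _) (FB 0).
apply: contrapT => noC.
have /choice[x xP] (i : nat) : exists x : nat * (R * R),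
    e * x.1%:R + i%:R < `|iter x.1 F x.2 - x.2 - x.1%:R *: v|.
  apply: contrapT => H; apply: noC; exists i%:R => n z; rewrite leNgt.
  by apply/negP => h; apply: H; exists (n, z).
pose n i := (x i).1; pose z i := (x i).2.
pose D := B + `|v| + 1.
have D0 : 0 < D by rewrite ltr_wpDl // addr_ge0.
have nlarge i : i%:R < (n i)%:R * D.
  have ei : 0 <= e * (n i)%:R by rewrite mulr_ge0 // ltW.
  have := xP i; rewrite -/(n i) -/(z i) => h.
  have := ler_normB (iter (n i) F (z i) - z i) ((n i)%:R *: v).
  rewrite normrZ normr_nat.
  have := iter_displacement (n i) (z i) FB.
  have : 0 <= (n i)%:R :> R by [].
  by rewrite /D; nra.
have n0 i : 0 < (n i)%:R :> R.
  by rewrite -(pmulr_lgt0 _ D0) (le_lt_trans _ (nlarge i)).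
pose u i := (n i)%:R^-1 *: (iter (n i) F (z i) - z i).
have uB i : `|u i| <= B.
  rewrite normrZ normfV normr_nat ler_pdivrMl //.
  exact: iter_displacement.
have uv i : e < `|u i - v|.
  have -> : u i - v = (n i)%:R^-1 *: (iter (n i) F (z i) - z i - (n i)%:R *: v).
    by rewrite scalerBr scalerK // gt_eqF.
  rewrite normrZ normfV normr_nat ltr_pdivlMl // mulrC.
  by apply: le_lt_trans (xP i); rewrite lerDl.
have [p [_ up]] : (`[- B, B] `*` `[- B, B]) `&` cluster (u @ \oo) !=set0.
  apply: square_compact; exists 0%N => // i _ /=; have := uB i.
  by rewrite plane_norm_le !ler_norml => /andP[h1 h2]; split; rewrite /= in_itv.
have /choice[j jP] (i : nat) : exists j, (i <= j)%N /\ `|p - u j| < i.+1%:R^-1.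
  have [||_ [[j ij <-] /=]] := up [set u j | j in [set j | (i <= j)%N]] (ball p i.+1%:R^-1).
  - by exists i => // k /= ik; exists k.
  - by apply: nbhsx_ballx; rewrite invr_gt0.
  by rewrite plane_ballE => pj; exists j.
have : rotation_set F p.
  exists (z \o j), (n \o j); split.
    apply/cvgnyPge => A; exists (Num.truncn (A%:R * D)).+1 => // i /= Ai.
    have [ij _] := jP i.
    have : A%:R * D < (n (j i))%:R * D.
      apply: lt_trans (nlarge (j i)); apply: lt_le_trans (truncnS_gt _) _.
      by rewrite ler_nat (leq_trans Ai).
    by rewrite ltr_pM2r // ltr_nat => /ltnW.
  apply/cvgrPdist_lt => d d0; have := near_infty_natSinv_lt (PosNum d0).
  by apply: filterS => i /=; apply: lt_trans; have [] := jP i.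
rewrite Fv => pv; have := near_infty_natSinv_lt (PosNum e0).
move=> [i _ /(_ i (leqnn i)) /=] ie; have [_] := jP i.
rewrite ltNge (le_trans (ltW ie)) // distrC pv ltW //; exact: uv.
Qed.

(** Apply the estimate for [G] at the endpoint of the backward orbit. *)
Lemma uniform_drift_inverse G G' w : cancel G' G -> uniform_drift G w ->
  uniform_drift G' (- w).
Proof.
move=> GK Gw e /Gw[C CP]; exists C => n z.
have GnK : iter n G (iter n G' z) = z.
  by elim: n => //= n IH; rewrite -iterS iterSr GK.
have := CP n (iter n G' z); rewrite GnK => h; rewrite -normrN.
by have -> : - (iter n G' z - z - n%:R *: - w) = z - iter n G' z - n%:R *: w by plane_ring.
Qed.

Lemma iter_shifted_power F n p k z : equivariant F -> lattice p ->
  iter k (fun z => iter n F z - p) z = iter (k * n) F z - k%:R *: p.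
Proof.
move=> FE lp; elim: k => [|k IH]; first by rewrite scale0r subr0.
rewrite iterS IH mulSn iterD -latticeN in lp *.
rewrite -scalerN (equivariant_iter _ FE) ?latticeMn //.
by rewrite -natr1 scalerDl scale1r scalerN opprD addrA.
Qed.

Lemma uniform_drift_power F v n p : equivariant F -> lattice p ->
  uniform_drift F v ->
  uniform_drift (fun z => iter n F z - p) (n%:R *: v - p).
Proof.
move=> FE lp Fv e e0.
have e1 : 0 < e / n.+1%:R by rewrite divr_gt0.
have [C CP] := Fv _ e1; exists C => k z; rewrite iter_shifted_power //.
have -> : iter (k * n) F z - k%:R *: p - z - k%:R *: (n%:R *: v - p) =
    iter (k * n) F z - z - (k * n)%:R *: v.
  by rewrite natrM; set a := iter _ _ _; plane_ring.
rewrite (le_trans (CP _ _)) // lerD2r natrM.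
have -> : e / n.+1%:R * (k%:R * n%:R) = e * k%:R * (n%:R / n.+1%:R) by ring.
rewrite ler_piMr ?mulr_ge0 // ?(ltW e0) //.
by rewrite ler_pdivrMr // mul1r ler_nat.
Qed.

(** Continuity of the inverse: for [y'] close to [y], the point [F' y'] is
    close to [F' y] up to a lattice vector [m], and applying [F] shows that [m]
    is close to [y' - y], hence zero. *)
Lemma equivariant_lift_inverse (f : torus R -> torus R) F :
  homeomorphism f -> is_lift f F -> equivariant F ->
  exists F', [/\ continuous F', cancel F F' & cancel F' F].
Proof.
move=> [_ [g [gc fK gK]]] [Fc Ff] FE.
have /choice[F' F'K] y : exists z, F z = y.
  have [z gz] := torus_proj_surj (g (torus_proj y)).
  exists (z + (y - F z)); rewrite FE ?subrKC //.
  by apply/torus_projP; rewrite Ff gz gK.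
have Finj : injective F.
  move=> z w Fzw; have lzw : lattice (z - w).
    by apply/torus_projP; rewrite -[LHS]fK -[RHS]fK -!Ff Fzw.
  move: Fzw; rewrite -{1}(subrKC w z) FE // => /eqP.
  by rewrite -subr_eq0 addrAC subrr add0r subr_eq0 => /eqP.
exists F'; split => //; last by move=> z; apply: Finj; rewrite F'K.
move=> y; apply/cvgrPdist_lt => e e0.
have : \forall c \near F' y, `|y - F c| < 1 / 2.
  have /cvgrPdist_lt := Fc (F' y); rewrite F'K; apply; exact: divr_gt0.
move=> /nbhs_ballP[d /= d0 dP].
have de0 : 0 < Num.min d e by rewrite lt_min d0.
have lF' y' : torus_proj (F' y') = g (torus_proj y').
  by rewrite -[LHS]fK -Ff F'K.
have gpc : continuous (g \o @torus_proj R).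
  move=> w; apply: continuous_comp; first exact: torus_proj_continuous.
  exact: gc.
have yy : \forall y' \near y, `|y - y'| < 1 / 2.
  by have /cvgrPdist_lt := @cvg_id _ (nbhs y); apply; exact: divr_gt0.
apply: filterS2 yy (lift_near gpc lF' y de0) => y' yy' [m [lm]].
rewrite lt_min => /andP[md me]; suff m0 : m = 0.
  by move: me; rewrite m0 subr0 distrC.
apply: small_lattice => //.
have : `|y - F (F' y' - m)| < 1 / 2 by apply: dP; rewrite plane_ballE distrC.
rewrite FE ?latticeN // F'K => h.
have -> : m = (y - (y' - m)) - (y - y') by plane_ring.
rewrite (le_lt_trans (ler_normB _ _)) //; lra.
Qed.

End Rotation.

(** * Returns of non-wandering points *)

Section Recurrence.
Variable R : realType.
Implicit Types (p q z w v m : R * R) (F G : R * R -> R * R).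

Lemma lift_iter (f : torus R -> torus R) F n z : is_lift f F ->
  torus_proj (iter n F z) = iter n f (torus_proj z).
Proof. by move=> [_ Ff]; elim: n => //= n <-; rewrite Ff. Qed.

Lemma rationally_independent_int (a b x y z : R) :
  rationally_independent a b ->
  x \is a Num.int -> y \is a Num.int -> z \is a Num.int ->
  x + y * a + z * b = 0 -> [/\ x = 0, y = 0 & z = 0].
Proof.
move=> ab /intrP[i ->] /intrP[j ->] /intrP[k ->].
rewrite -!(ratr_int R) => /ab[-> -> ->].
by rewrite raddf0.
Qed.

(** The determinant of two return vectors is an integral combination of 1 and
    of the coordinates of [v], hence vanishes only trivially. *)
Lemma parallel_return_vectors v (n k : nat) p q :
  rationally_independent v.1 v.2 -> lattice p -> lattice q ->
  cross (n%:R *: v - p) (k%:R *: v - q) = 0 -> n%:R *: q = k%:R *: p.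
Proof.
move=> vi /andP[p1 p2] /andP[q1 q2] D0.
have [||||_ h1 h2] := @rationally_independent_int v.1 v.2
  (p.1 * q.2 - p.2 * q.1) (k%:R * p.2 - n%:R * q.2) (n%:R * q.1 - k%:R * p.1) vi.
- by rewrite rpredB // rpredM.
- by rewrite rpredB // rpredM // rpred_nat.
- by rewrite rpredB // rpredM // rpred_nat.
- by rewrite -D0 /cross /= /GRing.scale /=; ring.
by apply: plane_eq; rewrite /= /GRing.scale /=; lra.
Qed.

Lemma return_vector_neq0 v (n : nat) p : (0 < n)%N ->
  rationally_independent v.1 v.2 -> lattice p -> n%:R *: v - p != 0.
Proof.
move=> n0 vi /andP[p1 p2]; apply/eqP => E.
have E1 : n%:R * v.1 - p.1 = 0 := congr1 fst E.
have [||||_ h _] := @rationally_independent_int v.1 v.2 (- p.1) n%:R 0 vi.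
- by rewrite rpredN.
- exact: rpred_nat.
- exact: rpred0.
- by rewrite mul0r addr0 addrC.
by move/eqP: h; rewrite pnatr_eq0 => /eqP h; rewrite h in n0.
Qed.

(** The orbit of a fixed point does not drift. *)
Lemma uniform_drift_no_fixpoint G w z : uniform_drift G w -> w != 0 -> G z != z.
Proof.
move=> Gw w0; apply/eqP => Gz.
have w1 : 0 < `|w| by rewrite normr_gt0.
have [C CP] := Gw (`|w| / 2) (divr_gt0 w1 (ltr0n _ 2)).
pose n := (Num.truncn (`|C| / (`|w| / 2))).+1.
have := CP n z; rewrite iter_fix // subrr sub0r normrN normrZ normr_nat.
have : `|C| / (`|w| / 2) < n%:R by exact: truncnS_gt.
rewrite ltr_pdivrMr ?divr_gt0 // => h1 h2.
by have := ler_norm C; lra.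
Qed.

Lemma non_wandering_return (f : torus R -> torus R) F z (r : R) :
  is_lift f F -> non_wandering_set f (torus_proj z) -> 0 < r ->
  exists (n : nat) p a, [/\ (0 < n)%N, lattice p, ball z r a &
    ball z r (iter n F a - p)].
Proof.
move=> Ff nw r0.
have [n [n0 [_ [[_ [a za <-] <-] [b zb ab]]]]] := nw _ (torus_proj_nbhs z r0).
move: ab; rewrite -(lift_iter n a Ff) => /esym/torus_projP l.
by exists n, (iter n F a - b), a; split => //; rewrite subKr.
Qed.

Lemma no_return_small_ball F v z (n : nat) p : continuous F -> equivariant F ->
  uniform_drift F v -> rationally_independent v.1 v.2 ->
  lattice p -> (0 < n)%N ->
  \forall d \near 0^'+, forall a, ball z d a -> ~ ball z d (iter n F a - p).
Proof.
move=> Fc FE Fv vi lp n0; pose G a := iter n F a - p.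
have Gz : G z != z.
  apply: (uniform_drift_no_fixpoint z (uniform_drift_power n FE lp Fv)).
  exact: return_vector_neq0.
have e0 : 0 < `|G z - z| / 2 by rewrite divr_gt0 // normr_gt0 subr_eq0.
have Gc : continuous G.
  by move=> a; apply: cvgB; [exact: iter_continuous|exact: cvg_cst].
have /nbhs_ballP[d /= d0 dP] : \forall a \near z, `|G z - G a| < `|G z - z| / 2.
  by move/cvgrPdist_lt: (Gc z); apply.
near=> s.
have sd : s < d by near: s; exact: (nbhs_right_lt d0).
have se : s < `|G z - z| / 2 by near: s; exact: (nbhs_right_lt e0).
move=> a; rewrite !plane_ballE => za zGa.
have Ga : `|G z - G a| < `|G z - z| / 2.
  by apply: dP; rewrite plane_ballE (lt_trans za).
have := ler_normB (G z - G a) (z - G a).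
have -> : G z - G a - (z - G a) = G z - z by plane_ring.
by move: zGa Ga se; rewrite -/(G a); lra.
Unshelve. all: by end_near. Qed.

(** The returns [(n, p)] of which the vector is parallel to that of [(k, q)]
    are those with [n *: q = k *: p], so that there is at most one [p] for each
    [n]. Along them the drift of a point is proportional to [n], whence a
    return to a disk of radius at most 1 happens before some fixed time [N].
    None of these finitely many maps fixes [z], so a smaller disk around [z]
    avoids all of them, and it still has a return since [z] is non-wandering. *)
Lemma nonparallel_return (f : torus R -> torus R) F v z (r : R) (k : nat) q :
  is_lift f F -> equivariant F -> uniform_drift F v ->
  rationally_independent v.1 v.2 -> non_wandering_set f (torus_proj z) ->
  0 < r -> (0 < k)%N -> lattice q ->
  exists (n : nat) p a, [/\ lattice p, n%:R *: q != k%:R *: p,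
    (0 < n)%N, ball z r a & ball z r (iter n F a - p)].
Proof.
move=> Ff FE Fv vi nw r0 k0 lq; have Fc := proj1 Ff.
set w := k%:R *: v - q; have w0 : 0 < `|w|.
  by rewrite normr_gt0 return_vector_neq0.
have kR0 : 0 < k%:R :> R by rewrite ltr0n.
pose c := `|w| / k%:R; have c0 : 0 < c by rewrite divr_gt0.
(* Along parallel returns the drift has speed [c]. *)
have [C CP] := Fv (c / 2) (divr_gt0 c0 (ltr0n _ 2)).
pose N := (Num.truncn ((C + 2) / (c / 2))).+1.
pose bad (n : nat) (d : R) := (0 < n)%N -> forall p a, lattice p ->
  n%:R *: q = k%:R *: p -> ball z d a -> ~ ball z d (iter n F a - p).
have bad1 n : \forall d \near 0^'+, bad n d.
  have [n0|] := ltnP 0 n; last by rewrite leqNgt => /negP n0; apply: nearW => d /n0.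
  have [lp|nlp] := boolP (lattice ((n%:R / k%:R) *: q)).
    have := no_return_small_ball z Fc FE Fv vi lp n0.
    apply: filterS => d dP _ p a _ pq; suff -> : p = (n%:R / k%:R) *: q by exact: dP.
    by rewrite mulrC -scalerA pq scalerK // gt_eqF.
  apply: nearW => d _ p a lp pq; suff pE : p = (n%:R / k%:R) *: q.
    by rewrite -pE lp in nlp.
  by rewrite mulrC -scalerA pq scalerK // gt_eqF.
have {bad1} badN : \forall d \near (0 : R)^'+, forall n, (n < N)%N -> bad n d.
  elim: N => [|N IH]; first exact: nearW.
  apply: filterS2 IH (bad1 N) => d dN dn n; rewrite ltnS leq_eqVlt.
  by case/orP => [/eqP ->|/dN].
have [d [dN d0 dr d1]] : exists d, [/\ forall n, (n < N)%N -> bad n d, 0 < d, d <= r & d <= 1].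
  near (0 : R)^'+ => d; exists d; split; near: d => //.
  - exact: nbhs_right_gt.
  - exact: nbhs_right_le.
  - exact: nbhs_right_le.
have [n [p [a [n0 lp za zGa]]]] := non_wandering_return Ff nw d0.
exists n, p, a; split => //; try exact: (le_ball dr).
apply/eqP => pq.
have nN : (N <= n)%N by rewrite leqNgt; apply/negP => /dN /(_ n0 p a lp pq za zGa).
have npE : n%:R *: v - p = (n%:R / k%:R) *: w.
  rewrite /w scalerBr scalerA divfK ?gt_eqF //; congr (_ - _).
  by rewrite mulrC -scalerA pq scalerK // gt_eqF.
have h1 : `|n%:R *: v - p| = n%:R * c.
  by rewrite npE normrZ normrM normfV !normr_nat /c mulrAC mulrA.
have h2 : `|n%:R *: v - p| <= c / 2 * n%:R + C + 2.
  have -> : n%:R *: v - p = (z - a) - (z - (iter n F a - p)) - (iter n F a - a - n%:R *: v).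
    by set b := iter _ _ _; plane_ring.
  rewrite (le_trans (ler_normB _ _)) // addrC lerD //.
  rewrite (le_trans (ler_normB _ _)) //; move: za zGa; rewrite !plane_ballE; lra.
have : (C + 2) / (c / 2) < n%:R.
  by apply: lt_le_trans (truncnS_gt _) _; rewrite ler_nat.
by rewrite ltr_pdivrMr ?divr_gt0 //; lra.
Unshelve. all: by end_near. Qed.

End Recurrence.

Theorem theoremA (R : realType) (f : torus R -> torus R) :
  non_resonant f -> weakly_transitive_on f (non_wandering_set f).
Proof.
move=> [[fhomeo fid] [F [v [Ff Frot vi]]]] U V oU oV [x [Ux nx]] [y [Vy ny]].
have FE := lift_equivariant fid Ff; have Fc := proj1 Ff.
have Fv := singleton_rotation_set_drift Fc FE Frot.
have [F' [F'c FK F'K]] := equivariant_lift_inverse fhomeo Ff FE.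
have disk (W : set (torus R)) u : open W -> W u ->
    exists z r, [/\ torus_proj z = u, 0 < r & forall a, ball z r a -> W (torus_proj a)].
  move=> oW Wu; have [z zu] := torus_proj_surj u.
  have : \forall a \near z, W (torus_proj a).
    by apply: torus_proj_continuous; rewrite zu; exact: open_nbhs_nbhs.
  by move=> /nbhs_ballP[r r0 rP]; exists z, r.
have [a [r [ax r0 aU]]] := disk U x oU Ux; subst x.
have [b [s [byy s0 bV]]] := disk V y oV Vy; subst y.
have [k [q [b0 [k0 lq bb0 bb1]]]] := non_wandering_return Ff ny s0.
have [n [p [a0 [lp npq n0 aa0 aa1]]]] := nonparallel_return Ff FE Fv vi nx r0 k0 lq.
(* Forward images of the first disk under [G] and backward images of the second
   one under [H] are joined into drifting curves. *)
pose G z := iter n F z - p; pose H z := iter k F z - q.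
pose H' z := iter k F' (z + q).
have itK j : cancel (iter j F) (iter j F').
  by elim: j => // j IH z; rewrite iterSr /= FK IH.
have itK' j : cancel (iter j F') (iter j F).
  by elim: j => // j IH z; rewrite iterSr /= F'K IH.
have HK : cancel H H' by move=> z; rewrite /H /H' subrK itK.
have H'K : cancel H' H by move=> z; rewrite /H /H' itK' addrK.
have Gc : continuous G.
  by move=> z; apply: cvgB; [exact: iter_continuous|exact: cvg_cst].
have H'c : continuous H'.
  move=> z; apply: (@continuous_comp _ _ _ (fun z : R * R => z + q) (iter k F')).
    by apply: cvgD; [exact: cvg_id|exact: cvg_cst].
  exact: iter_continuous.
have Gw := uniform_drift_power n FE lp Fv.
have H'w := uniform_drift_inverse H'K (uniform_drift_power k FE lq Fv).
have D0 : cross (n%:R *: v - p) (- (k%:R *: v - q)) != 0.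
  apply: contra npq => /eqP D; apply/eqP; apply: (parallel_return_vectors vi lp lq).
  by apply: oppr_inj; rewrite oppr0 -D /cross /=; ring.
have Gcurves := return_drifting_curves Gc Gw aa0 aa1.
have H'curves : drifting_curves [set z | exists j c, ball b s c /\ z = iter j.+1 H' c]
    (- (k%:R *: v - q)).
  by apply: (@return_drifting_curves _ H' _ b s (H b0)) => //; rewrite HK.
have [_ [_ [[i [c [ac ->]]] [j [d [bd ->]]] l]]] :=
  drifting_curves_cross D0 Gcurves H'curves.
have fG t z : torus_proj (iter t G z) = iter (t * n) f (torus_proj z).
  rewrite iter_shifted_power // -scalerN torus_projD ?latticeMn ?latticeN //.
  by rewrite (lift_iter _ _ Ff).
have fH t z : torus_proj (iter t H z) = iter (t * k) f (torus_proj z).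
  rewrite iter_shifted_power // -scalerN torus_projD ?latticeMn ?latticeN //.
  by rewrite (lift_iter _ _ Ff).
exists (j.+1 * k + i.+1 * n)%N; split; first by rewrite addn_gt0 muln_gt0 k0.
exists (torus_proj d); split; last exact: bV.
exists (torus_proj c); first exact: aU.
have HjK t z : iter t H (iter t H' z) = z.
  by elim: t => // t IH; rewrite iterSr /= H'K IH.
by rewrite iterD -fG (iffRL (torus_projP _ _) l) -fH HjK.
Qed.
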